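(* Let $n,k$ be positive integers with $n>3k$. Then $\alpha(P(n,k)) \geq \left\lfloor \frac{4n}{5}\right\rfloor$, and hence $\beta(P(n,k))\leq n+\left\lceil\frac{n}{5}\right\rceil$ (that is, the Behsaz–Hatami–Mahmoodian conjecture holds for such $n,k$).
   Context: For positive integers $n,k$ with $n>2k$, the generalized Petersen graph $P(n,k)$ is the graph with vertex set $\{u_i,v_i : i=1,\dots,n\}$ (so $2n$ vertices) and edge set $\{u_iu_{i+1},\ u_iv_i,\ v_iv_{i+k} : i=1,\dots,n\}$, subscripts being reduced modulo $n$. For a graph $G$, $\alpha(G)$ denotes the independence number (the size of a largest set of pairwise non-adjacent vertices) and $\beta(G)$ denotes the minimum size of a vertex cover (a set of vertices containing at least one endpoint of every edge). The Behsaz–Hatami–Mahmoodian conjecture asserts that $\beta(P(n,k)) \leq n+\lceil n/5\rceil$ for all $n>2k$. *)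

(* Defs.v *)
From mathcomp Require Import all_boot.
From mathcomp Require Import zify.

Set Implicit Arguments.
Unset Strict Implicit.
Unset Printing Implicit Defensive.

(* Simple graphs are symmetric irreflexive relations [e] on a finite type. *)
Section GraphParameters.
Variables (T : finType) (e : rel T).

Definition independent (S : {set T}) : bool :=
  [forall x in S, forall y in S, ~~ e x y].

Definition vertex_cover (S : {set T}) : bool :=
  [forall x, forall y, e x y ==> (x \in S) || (y \in S)].

Definition independence_number : nat :=
  \max_(S : {set T} | independent S) #|S|.

(* [setT] is always a vertex cover, see [vertex_cover_setT]. *)
Definition vertex_cover_number : nat :=
  #|[arg min_(S < [set: T] | vertex_cover S) #|S| ]|.

Lemma vertex_cover_setT : vertex_cover [set: T].
Proof. by apply/forallP => x; apply/forallP => y; rewrite !inE implybT. Qed.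

End GraphParameters.

(* Subscripts are taken in {0, ..., n-1}; [inl i] is the outer vertex u_i and
   [inr i] the inner vertex v_i. *)
Definition gp_vertex (n : nat) : finType := ('I_n + 'I_n)%type.

Definition gp_arc (n k : nat) : rel (gp_vertex n) := fun x y =>
  match x, y with
  | inl i, inl j => j == i + 1 %[mod n]
  | inl i, inr j => i == j
  | inr i, inr j => j == i + k %[mod n]
  | inr _, inl _ => false
  end.

Definition gen_petersen (n k : nat) : rel (gp_vertex n) :=
  fun x y => gp_arc k x y || gp_arc k y x.
Arguments gen_petersen : clear implicits.

Lemma gen_petersen_sym n k : symmetric (gen_petersen n k).
Proof. by move=> x y; rewrite /gen_petersen orbC. Qed.

Lemma gen_petersen_irr n k :
  0 < k -> 2 * k < n -> irreflexive (gen_petersen n k).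
Proof.
move=> k_gt0 lt_2k_n.
have shiftF (d : nat) (i : 'I_n) : 0 < d < n -> (i == i + d %[mod n]) = false.
  case/andP=> d_gt0 lt_d_n; rewrite -{1}[nat_of_ord i]addn0 eqn_modDl.
  by rewrite mod0n modn_small // ltn_eqF.
by case=> i; rewrite /gen_petersen /= orbb shiftF //; lia.
Qed.

Definition ceil_divn (m d : nat) : nat := m %/ d + ~~ (d %| m).

Lemma ceil_divn_leq m d q : 0 < d -> (ceil_divn m d <= q) = (m <= q * d).
Proof.
move=> d_gt0; rewrite /ceil_divn; case: (boolP (d %| m)) => [dvd_dm|ndvd].
  by rewrite addn0 leq_divLR.
rewrite addn1 ltn_divLR // ltn_neqAle andb_idl // => _.
by apply: contraNneq ndvd => ->; rewrite dvdn_mull.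
Qed.

(* Main.v *)
Require Import Defs.
From mathcomp Require Import all_boot.
From mathcomp Require Import zify.

(** Every spoke [{u_i, v_i}] meets an independent set at most once, so we label
    the subscripts by [u] or [v] and drop a few of them to destroy the edges
    joining equal labels.  For [k] odd the labels alternate, and conflicts only
    occur where the indices wrap around modulo [n].  For [k >= 4] even the labels
    alternate inside blocks of length [k], with opposite phases in consecutive
    blocks; besides the wrap-around this costs one subscript per [2 * k].  For
    [k = 2] the periodic pattern [u v v u -] of length 5 is used, and the last
    subscript is dropped. *)

Lemma card_ord_mem_seq (n : nat) (Z : seq nat) :
  #|[set i : 'I_n | (i : nat) \in Z]| <= size Z.
Proof.
rewrite cardE -(size_map val); apply: uniq_leq_size.
  by rewrite (map_inj_uniq val_inj) enum_uniq.
by move=> z /mapP[i]; rewrite mem_enum inE => iZ ->.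
Qed.

(* [f i] selects u_i, [~~ f i] selects v_i, and [Z] lists the dropped subscripts. *)
Lemma independent_of_labelling (n k : nat) (f : nat -> bool) (Z : seq nat) :
  0 < k < n ->
  (forall i, i.+1 < n -> f i -> f i.+1 -> (i \in Z) || (i.+1 \in Z)) ->
  (f n.-1 -> f 0 -> (n.-1 \in Z) || (0 \in Z)) ->
  (forall i, i + k < n -> ~~ f i -> ~~ f (i + k) ->
     (i \in Z) || (i + k \in Z)) ->
  (forall p, p < k -> ~~ f (p + (n - k)) -> ~~ f p ->
     (p + (n - k) \in Z) || (p \in Z)) ->
  exists2 S, independent (gen_petersen n k) S & n <= #|S| + size Z.
Proof.
move=> /andP[k_gt0 lt_kn] Hu Hu0 Hv Hv0.
pose S := [set x : gp_vertex n | match x with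
  | inl i => f i && ((i : nat) \notin Z)
  | inr i => ~~ f i && ((i : nat) \notin Z) end].
have arcF x y : x \in S -> y \in S -> ~~ gp_arc k x y.
  rewrite !inE; case: x => [i|i]; case: y => [j|j] //=.
  - move=> /andP[fi iZ] /andP[fj jZ]; rewrite (modn_small (ltn_ord j)).
    apply/eqP => ej; have [lt_in|le_ni] := ltnP i.+1 n.
      move: (Hu i lt_in fi); rewrite addn1 modn_small // in ej.
      by rewrite -ej (negPf iZ) (negPf jZ) => /(_ fj).
    have ei : i = n.-1 :> nat by have := ltn_ord i; lia.
    have e0 : j = 0 :> nat by rewrite ej ei addn1 prednK ?modnn //; lia.
    by rewrite ei e0 in fi fj iZ jZ; have := Hu0 fi fj; rewrite (negPf iZ) (negPf jZ).
  - move=> /andP[fi iZ] /andP[fj jZ]; apply/eqP => eij; move: fj.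
    by rewrite -eij fi.
  - move=> /andP[fi iZ] /andP[fj jZ]; rewrite (modn_small (ltn_ord j)).
    apply/eqP => ej; have [lt_in|le_ni] := ltnP (i + k) n.
      move: (Hv i lt_in fi); rewrite modn_small // in ej.
      by rewrite -ej (negPf iZ) (negPf jZ) => /(_ fj).
    have lt_in := ltn_ord i.
    have ej' : j = i + k - n :> nat.
      by rewrite ej -{1}(subnK le_ni) modnDr modn_small //; lia.
    have ei : i = j + (n - k) :> nat by rewrite ej'; lia.
    rewrite ei in fi iZ; have lt_jk : j < k by lia.
    by have := Hv0 j lt_jk fi fj; rewrite (negPf iZ) (negPf jZ).
exists S.
  apply/forallP => x; apply/implyP => xS; apply/forallP => y; apply/implyP => yS.
  by rewrite /gen_petersen negb_or !arcF.
(* Each subscript outside [Z] sends its labelled vertex into [S], injectively. *)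
pose g (i : 'I_n) : gp_vertex n := if f i then inl i else inr i.
have g_inj : injective g.
  by move=> i j; rewrite /g; case: ifP; case: ifP => // _ _ [].
have sub : g @: [set i : 'I_n | (i : nat) \notin Z] \subset S.
  apply/subsetP => x /imsetP[i]; rewrite inE => iZ ->.
  by rewrite inE /g; case: ifP => -> /=.
have := subset_leq_card sub; rewrite (card_imset _ g_inj).
have := cardsC [set i : 'I_n | (i : nat) \in Z]; rewrite card_ord.
have -> : ~: [set i : 'I_n | (i : nat) \in Z] = [set i : 'I_n | (i : nat) \notin Z].
  by apply/setP => i; rewrite !inE.
have := card_ord_mem_seq n Z; lia.
Qed.

(** With [u] on even subscripts, equal labels meet only for [n] odd: on the outer wrap-around edge,
    and on inner ones between an odd [p < k] and [p + (n - k)]. Dropping [n.-1] and these [k./2]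
    values of [p] costs [(k + 1) / 2], which [3 * k < n] keeps within the bound. *)
Lemma independent_odd (n k : nat) : odd k -> 3 * k < n ->
  exists2 S, independent (gen_petersen n k) S & n <= #|S| + ceil_divn n 5.
Proof.
move=> k_odd lt_3k_n.
pose Z := if odd n then n.-1 :: [seq j.*2.+1 | j <- iota 0 k./2] else [::].
have sizeZ : size Z <= ceil_divn n 5.
  by rewrite /Z /ceil_divn; case: ifP => //= n_odd; rewrite size_map size_iota; lia.
have [|||||S S_ind S_card] :=
  @independent_of_labelling n k (fun i => ~~ odd i) Z; last first.
- by exists S => //; lia.
- move=> p lt_pk p1 p2; rewrite /Z; case: ifP => n_odd; last by lia.
  apply/orP; right; rewrite inE; apply/orP; right.
  by apply/mapP; exists p./2; rewrite ?mem_iota; lia.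
- by move=> i; lia.
- by move=> n1 _; rewrite /Z ifT ?inE ?eqxx //; lia.
- by move=> i; lia.
- by lia.
Qed.

Lemma independent_two (n : nat) : 6 < n ->
  exists2 S, independent (gen_petersen n 2) S & n <= #|S| + ceil_divn n 5.
Proof.
move=> lt_6n.
(* If [5 %| n], the periodic list already ends with [n.-1]. Of the wrap-around edges, only the inner
   one at subscript 0 avoids [n.-1], and 0 is labelled [u]. *)
pose Z := (if 5 %| n then [::] else [:: n.-1]) ++
  [seq (5 * j + 4) | j <- iota 0 (n %/ 5)].
have sizeZ : size Z <= ceil_divn n 5.
  rewrite /Z /ceil_divn size_cat size_map size_iota.
  by case: (5 %| n) => /=; lia.
have memZ i : (i \in Z) = (i < n) && ((i == n.-1) || (i %% 5 == 4)).
  rewrite /Z mem_cat; apply/idP/idP.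
    case/orP; first by case: ifP => //; rewrite inE => _ /eqP ->; lia.
    by case/mapP => j; rewrite mem_iota => lt_j ->; lia.
  case/andP => lt_in H; have [i4|i4] := boolP (i %% 5 == 4).
    apply/orP; right; apply/mapP; exists (i %/ 5); last by lia.
    by rewrite mem_iota; lia.
  by apply/orP; left; rewrite ifF ?inE; lia.
have [|||||S S_ind S_card] :=
  @independent_of_labelling n 2 (fun i => (i %% 5 == 0) || (i %% 5 == 3)) Z; last first.
- by exists S => //; lia.
- by move=> p; rewrite !memZ; lia.
- by move=> p; rewrite !memZ; lia.
- by rewrite !memZ; lia.
- by move=> p; rewrite !memZ; lia.
- by lia.
Qed.

Lemma independent_even (n k : nat) : ~~ odd k -> 3 < k -> 3 * k < n ->
  exists2 S, independent (gen_petersen n k) S & n <= #|S| + ceil_divn n 5.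
Proof.
move=> k_even lt_3k lt_3k_n.
have k_gt0 : 0 < k by lia.
pose q := n %/ (2 * k); pose r := n %% (2 * k).
have nE : n = (2 * q) * k + r by rewrite mulnAC mulnC -divn_eq.
have lt_r : r < 2 * k by rewrite ltn_mod; lia.
have q_gt0 : 0 < q by rewrite divn_gt0; lia.
clearbody q r; have divE a b : b < k -> (a * k + b) %/ k = a.
  by move=> lt_bk; rewrite divnMDl // divn_small // addn0.
(* In the last [k] subscripts the block changes at [n - k + t]. *)
pose t := if r <= k then k - r else 2 * k - r.
pose Zwrap := if odd n == (r <= k)
  then n.-1 :: [seq j.*2.+1 | j <- iota 0 t./2]
  else [seq k.-1 - j.*2 | j <- iota 0 (uphalf (k - t))].
(* Where an odd block meets an even one, both ends are labelled [u]; at the other boundaries both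
   are [v], which is harmless on an outer edge. *)
pose Z := [seq (2 * j.+1 * k).-1 | j <- iota 0 q] ++ Zwrap.
have sizeZ : size Z <= ceil_divn n 5.
  rewrite size_cat size_map size_iota.
  have -> : size Zwrap =
      if odd n == (r <= k) then (t./2).+1 else uphalf (k - t).
    by rewrite /Zwrap; case: ifP; rewrite /= size_map size_iota.
  have ceilE : 5 * ceil_divn n 5 >= n by rewrite mulnC -ceil_divn_leq.
  (* For [q = 1], [3 * k < n] forces [k < r]. *)
  have [q1|q2] : q = 1 \/ 2 <= q by lia.
    rewrite q1 in nE *; rewrite /t.
    by case: (leqP r k) => hr; case: (boolP (odd n)) => hn /=; lia.
  (* This is [(q - 2) * (k - 4) >= 0]; the rest is linear in [q * k]. *)
  have qk_ge : 2 * k + 4 * q <= q * k + 8 by nia.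
  have qkE : n = 2 * (q * k) + r by rewrite mulnA.
  rewrite /t; case: (leqP r k) => hr; case: (boolP (odd n)) => hn /=; lia.
have [|||||S S_ind S_card] :=
  @independent_of_labelling n k (fun i => odd i == odd (i %/ k)) Z; last first.
- by exists S => //; lia.
- move=> p lt_pk; rewrite (divn_small lt_pk) => fi fp.
  have p_odd : odd p by lia.
  apply/orP; right; rewrite mem_cat; apply/orP; right.
  have lt_pt : (p < t) = (odd n == (r <= k)).
    move: fi; rewrite /t; case: (leqP r k) => hr; case: (ltnP p) => hp fi.
    - have iE : p + (n - k) = (2 * q).-1 * k + (p + r) by nia.
      rewrite iE divE in fi; lia.
    - have iE : p + (n - k) = (2 * q) * k + (p + r - k) by nia.
      rewrite iE divE in fi; lia.
    - have iE : p + (n - k) = (2 * q) * k + (p + r - k) by nia.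
      rewrite iE divE in fi; lia.
    - have iE : p + (n - k) = (2 * q).+1 * k + (p + r - 2 * k) by nia.
      rewrite iE divE in fi; lia.
  rewrite /Zwrap -lt_pt; clear -k_even p_odd lt_pk; clearbody t.
  case: ltnP => hp.
    by rewrite inE; apply/orP; right; apply/mapP; exists p./2; rewrite ?mem_iota; lia.
  by apply/mapP; exists ((k - p)./2); rewrite ?mem_iota; lia.
(* Adding the even [k] keeps the parity and moves to the next block, so the label flips. *)
- by move=> i _; rewrite divnDr ?dvdnn // divnn k_gt0; lia.
- move=> fn _; apply/orP; left; rewrite mem_cat.
  (* If [r = 0], then [n.-1] is itself the last block boundary dropped. *)
  have [r0|r_gt0] := posnP r.
    apply/orP; left; apply/mapP; exists q.-1; first by rewrite mem_iota; lia.
    by rewrite prednK // nE r0 addn0.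
  apply/orP; right; rewrite /Zwrap ifT ?inE ?eqxx //.
  move: fn; case: (leqP r k) => hr.
    have -> : n.-1 = (2 * q) * k + r.-1 by lia.
    by rewrite divE; lia.
  have -> : n.-1 = (2 * q).+1 * k + (r.-1 - k) by lia.
  by rewrite divE; lia.
- move=> i lt_in; have := divn_eq i k; have := ltn_pmod i k_gt0.
  move: (i %/ k) (i %% k) => a b lt_bk iE fi.
  have [lt_Sbk|le_kSb] := ltnP b.+1 k.
    have -> : i.+1 = a * k + b.+1 by lia.
    by rewrite divE // => fSi; lia.
  have SiE : i.+1 = a.+1 * k by nia.
  have Si_even : odd i.+1 = false by rewrite SiE oddM (negPf k_even) andbF.
  (* The block index [a] is odd, because [i] is odd and labelled [u]. *)
  have aE : 2 * (a./2).+1 = a.+1 by move: fi Si_even => /=; lia.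
  have lt_aq : a./2 < q.
    have : a.+1 * k < (2 * q + 2) * k by rewrite -SiE mulnDl; lia.
    by rewrite ltn_pmul2r //; lia.
  move=> _; apply/orP; left; rewrite mem_cat; apply/orP; left.
  by apply/mapP; exists a./2; rewrite ?mem_iota // aE -SiE.
- by lia.
Qed.

Lemma independent_gen_petersen (n k : nat) : 0 < k -> 3 * k < n ->
  exists2 S, independent (gen_petersen n k) S & n <= #|S| + ceil_divn n 5.
Proof.
move=> k_gt0 lt_3k_n; have [k_odd|k_even] := boolP (odd k).
  exact: independent_odd.
have [k2|k_neq2] := eqVneq k 2; last by apply: independent_even => //; lia.
by rewrite k2 in lt_3k_n *; apply: independent_two; lia.
Qed.

Lemma vertex_cover_setC (T : finType) (e : rel T) (S : {set T}) :
  independent e S -> vertex_cover e (~: S).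
Proof.
move=> S_ind; apply/forallP => x; apply/forallP => y; apply/implyP => exy.
rewrite !inE -negb_and; apply: contraL exy => /andP[xS yS].
by move/forallP: S_ind => /(_ x)/implyP/(_ xS)/forallP/(_ y)/implyP/(_ yS).
Qed.

Theorem corollary3 (n k : nat) (n_gt0 : 0 < n) (k_gt0 : 0 < k)
    (lt_3k_n : 3 * k < n) :
  (4 * n) %/ 5 <= independence_number (gen_petersen n k) /\
  vertex_cover_number (gen_petersen n k) <= n + ceil_divn n 5.
Proof.
have [S S_ind S_card] := independent_gen_petersen n k k_gt0 lt_3k_n.
split.
  (* Here [n] minus the ceiling of [n / 5] is the floor of [4 * n / 5]. *)
  apply: leq_trans (leq_bigmax_cond _ S_ind); move: S_card.
  by rewrite /ceil_divn; lia.
rewrite /vertex_cover_number; case: arg_minnP => [|C _ C_min].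
  exact: vertex_cover_setT.
apply: leq_trans (C_min _ (vertex_cover_setC _ _ _ S_ind)) _.
have := cardsC S; rewrite card_sum card_ord; lia.
Qed.
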